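(* For every oriented graph $D$ and every choice of positive integers $k$ and $\ell$, there exists an oriented graph $D^*$ along with a surjective homomorphism $\psi\colon V(D^* )\to V(D)$ (from $D^*$ to $D$) such that: (i) $\mathrm{girth}(D^* )\geq \ell$; (ii) for every oriented graph $C$ with at most $k$ vertices, there exists a homomorphism from $D^*$ to $C$ if and only if there exists a homomorphism from $D$ to $C$; and (iii) for every $D$-pointed oriented graph $C$ with at most $k$ vertices and for every homomorphism $\varphi\colon V(D^* )\to V(C)$ (from $D^*$ to $C$) there exists a unique homomorphism $f\colon V(D)\to V(C)$ (from $D$ to $C$) such that $\varphi=f\circ\psi$.
   Context: An oriented graph $D$ is a digraph with vertex set $V(D)$ and arc set $A(D)$ such that for every pair of vertices $u,v$ at most one of $uv$ and $vu$ is in $A(D)$; oriented graphs are always finite and loopless, without multiple arcs. Cycles are directed cycles, and the girth of an oriented graph is the length of a shortest directed cycle in it (with the convention that the girth is infinite if there is no directed cycle). For oriented graphs $D$ and $C$, a homomorphism from $D$ to $C$ is a map $f\colon V(D)\to V(C)$ such that $xy\in A(D)$ implies $f(x)f(y)\in A(C)$; such a homomorphism is also called a $C$-colouring of $D$. Surjectivity of $\psi$ means surjectivity as a map of vertex sets. For oriented graphs $C$ and $D$, $C$ is $D$-pointed if there do not exist two distinct $C$-colourings of $D$ that agree on all but one vertex of $D$. *)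

(* Defs.v *)
From mathcomp Require Import all_boot.

Set Implicit Arguments.
Unset Strict Implicit.
Unset Printing Implicit Defensive.

(* The vertex set of an oriented graph may be empty. *)
Record oriented_graph := OrientedGraph {
  vertex :> finType;
  arc : rel vertex;
  arc_irrefl : irreflexive arc;
  arc_antisym : forall u v : vertex, ~~ (arc u v && arc v u)
}.

Definition has_dicycle (D : oriented_graph) (n : nat) : bool :=
  [exists c : n.-tuple D, (0 < n) && ucycleb (@arc D) c].

(* A directed cycle has pairwise distinct vertices, hence length between 1
   and the number of vertices; [None] stands for an infinite girth.  See
   [girth_SomeP] and [girth_NoneP]. *)
Definition girth (D : oriented_graph) : option nat :=
  ohead [seq n <- iota 1 #|vertex D| | has_dicycle D n].

Definition girth_geq (D : oriented_graph) (l : nat) : bool :=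
  if girth D is Some g then l <= g else true.

Definition is_hom (D C : oriented_graph) (f : {ffun D -> C}) : Prop :=
  forall x y : D, arc x y -> arc (f x) (f y).

Definition hom_exists (D C : oriented_graph) : Prop :=
  exists f : {ffun D -> C}, is_hom f.

Definition surjective (S T : Type) (f : S -> T) : Prop :=
  forall y : T, exists x : S, f x = y.

(* [pointed D C] says that C is D-pointed. *)
Definition pointed (D C : oriented_graph) : Prop :=
  ~ exists f g : {ffun D -> C},
      [/\ is_hom f, is_hom g, f <> g &
          exists v : D, forall u : D, u <> v -> f u = g u].

Lemma has_dicycleP (D : oriented_graph) (n : nat) :
  reflect (exists c : seq D, [/\ 0 < n, size c = n & ucycle (@arc D) c])
          (has_dicycle D n).
Proof.
apply: (iffP existsP) => [[c /andP[n0 cc]]|[c [n0 /eqP sc cc]]].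
  by exists c; rewrite size_tuple.
by exists (Tuple sc); rewrite n0.
Qed.

Lemma has_dicycle_bound (D : oriented_graph) (n : nat) :
  has_dicycle D n -> n \in iota 1 #|vertex D|.
Proof.
case/has_dicycleP=> c [n0 sc /andP[_ /card_uniqP cc]].
rewrite mem_iota n0 add1n ltnS -sc -cc; exact: max_card.
Qed.

Lemma girth_SomeP (D : oriented_graph) (g : nat) :
  girth D = Some g <->
  has_dicycle D g /\ (forall n, has_dicycle D n -> g <= n).
Proof.
have srt : sorted ltn [seq n <- iota 1 #|vertex D| | has_dicycle D n].
  by apply: sorted_filter; [exact: ltn_trans | exact: iota_ltn_sorted].
have memE n : (n \in [seq n <- iota 1 #|vertex D| | has_dicycle D n])
              = has_dicycle D n.
  by rewrite mem_filter andb_idr //; apply: has_dicycle_bound.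
rewrite /girth; move: srt memE; case: [seq n <- _ | _] => [|h s] /= srt memE.
  by split=> // -[]; rewrite -memE.
have hle n : has_dicycle D n -> h <= n.
  rewrite -memE inE => /predU1P[->//|ns]; apply: ltnW.
  by move/(order_path_min ltn_trans)/allP: srt; apply.
have hh : has_dicycle D h by rewrite -memE mem_head.
split=> [[<-]//|[gc gle]]; congr Some.
by apply/eqP; rewrite eqn_leq hle //= gle.
Qed.

Lemma girth_NoneP (D : oriented_graph) :
  girth D = None <-> (forall n, ~~ has_dicycle D n).
Proof.
rewrite /girth; split=> [|noc].
  case E: [seq n <- _ | _] => // _ n; apply/negP => nc.
  have := has_dicycle_bound nc.
  by move=> ni; have := in_nil n; rewrite -E mem_filter nc ni.
by rewrite (eq_filter (a2 := pred0)) ?filter_pred0 // => n; apply/negbTE.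
Qed.

(* Main.v *)
From mathcomp Require Import all_boot zify.
Require Import Defs.

Set Implicit Arguments.
Unset Strict Implicit.
Unset Printing Implicit Defensive.

(** The graph D* is a categorical product D x W, with psi the first projection,
for a digraph W of large girth that is rigid for colourings with few colours.

A homomorphism phi from D x W to C is the same thing as a colouring of W by
the maps D -> C, sending w to phi(-, w): it respects the arcs of the
exponential digraph C^D, in which f -> g when uv in A(D) implies
f(u)g(v) in A(C).  The loops of C^D are exactly the homomorphisms D -> C, and
C is D-pointed only if no loop of C^D lies on a directed 2-cycle with another
vertex ([pointed_loops_isolated]): if f -> f, f -> g and g -> f, then replacing
the value of f at a single v by g(v) is again a homomorphism, so f(v) = g(v).
There are at most K = k^|D| colours.  Everything thus reduces to a digraph W
without short closed walks such that every colouring of W with at most K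
colours, respecting a relation R whose loops are isolated in this sense, is
constant and equal to a loop of R ([exists_rigid_digraph]).  For (iii) this
constant is the wanted f.  For (ii), if C^D had no loop then its loops would
be vacuously isolated, and the constant would be a loop after all.

To build W, start from a digraph E on n = (K + 3) a vertices without closed
walks of length below l in which every two sets A, B of size a are joined by
an arc from A to B ([exists_joining]).  Such an E is found greedily, a
derandomised form of the probabilistic construction.  Keep all outdegrees at
most d, so that only linearly many pairs of vertices would close a short cycle.
Every unjoined pair (A, B) then offers a quadratic number of arcs that may be
added, so by averaging one of them joins a constant fraction of the pairs that
are still unjoined.  After linearly many steps none of the at most 4^n pairs
is left.

Call a set of vertices trapped if each of its vertices has all its
in-neighbours or all its out-neighbours inside the set.  The joining property
leaves a gap in the sizes of trapped sets: they have fewer than 2a or more than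
n - a elements ([trapped_large]).  Let W be the digraph induced by E outside a
largest trapped set B of size below 2a.  In a colouring of W, call a colour
large if at least a vertices have it; some colour is large because W has more
than Ka vertices.  Large colours are joined both ways by arcs, so they are
loops of R on common 2-cycles, hence there is only one, f.  As the loop f is
isolated, a vertex of another colour cannot have both an in-neighbour and an
out-neighbour coloured f.  The vertices of other colours therefore form, with
B, a trapped set, which falls below the gap and so is B itself by maximality:
the colouring is constant ([constant_core]). *)

(** * Walks and girth *)

(** The vertices at the end of a walk of length exactly [i] from [x].  Walks,
rather than cycles, are what projects from a product to its factor. *)
Definition reach (V : finType) (E : {set V * V}) (x : V) (i : nat) : {set V} :=
  iter i (fun S : {set V} => [set z | [exists w in S, (w, z) \in E]]) [set x].

Definition outdeg (V : finType) (E : {set V * V}) (x : V) : nat :=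
  #|[set z | (x, z) \in E]|.

Definition large_girth (V : finType) (E : {set V * V}) (l : nat) : Prop :=
  forall x i, 0 < i < l -> x \notin reach E x i.

Definition unjoined (V : finType) (E : {set V * V}) (a : nat) :
    {set {set V} * {set V}} :=
  [set P : {set V} * {set V} |
    [&& a <= #|P.1|, a <= #|P.2| & [disjoint setX P.1 P.2 & E]]].

Definition joining (V : finType) (E : {set V * V}) (a : nat) : Prop :=
  forall A B : {set V}, a <= #|A| -> a <= #|B| ->
    exists x y, [/\ x \in A, y \in B & (x, y) \in E].

Lemma reachSP (V : finType) (E : {set V * V}) (x z : V) (i : nat) :
  reflect (exists2 w, w \in reach E x i & (w, z) \in E) (z \in reach E x i.+1).
Proof. by rewrite /reach iterS inE; apply: exists_inP. Qed.

Lemma reach_trans (V : finType) (E : {set V * V}) (x y z : V) (i j : nat) :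
  y \in reach E x i -> z \in reach E y j -> z \in reach E x (i + j).
Proof.
move=> yx; elim: j z => [|j IHj] z; first by rewrite addn0 inE => /eqP ->.
by case/reachSP=> w /IHj wx wz; rewrite addnS; apply/reachSP; exists w.
Qed.

Lemma card_reach (V : finType) (E : {set V * V}) (x : V) (d i : nat) :
  (forall z, outdeg E z <= d) -> #|reach E x i| <= d ^ i.
Proof.
move=> Ed; elim: i => [|i IHi]; first by rewrite cards1.
have sub : reach E x i.+1 \subset
    \bigcup_(w in reach E x i) [set z | (w, z) \in E].
  by apply/subsetP=> z /reachSP[w wx wz]; apply/bigcupP; exists w; rewrite ?inE.
apply: leq_trans (subset_leq_card sub) _.
have le_sum : forall S : {set V},
    #|\bigcup_(w in S) [set z | (w, z) \in E]| <= \sum_(w in S) d.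
  move=> S; apply: (big_rec2 (fun (X : {set V}) s => #|X| <= s)).
    by rewrite cards0.
  move=> w X s _ Xs; apply: leq_trans (leq_card_setU _ _).1 _.
  exact: leq_add (Ed w) Xs.
by apply: leq_trans (le_sum _) _; rewrite sum_nat_const expnSr leq_mul2r IHi orbT.
Qed.

Definition ball (V : finType) (E : {set V * V}) (x : V) (l : nat) : {set V} :=
  [set z | [exists i : 'I_l, z \in reach E x i]].

Lemma card_ball (V : finType) (E : {set V * V}) (x : V) (d l : nat) :
  0 < d -> (forall z, outdeg E z <= d) -> #|ball E x l| <= l * d ^ l.
Proof.
move=> d0 Ed.
have sub : ball E x l \subset \bigcup_(i < l) reach E x i.
  by apply/subsetP=> z; rewrite inE => /existsP[i zi]; apply/bigcupP; exists i.
apply: leq_trans (subset_leq_card sub) _.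
have -> : l * d ^ l = \sum_(i < l) d ^ l by rewrite sum_nat_const card_ord.
apply: (big_rec2 (fun (X : {set V}) s => #|X| <= s)); first by rewrite cards0.
move=> i X s _ Xs; apply: leq_trans (leq_card_setU _ _).1 _.
apply: leq_add Xs; apply: leq_trans (card_reach x i Ed) _.
by rewrite leq_pexp2l // ltnW.
Qed.

(** A walk that uses the new arc is cut before its first use and after its last
use of it; the part in between is dropped, so what remains only gets
shorter. *)
Lemma reach_add_arc (V : finType) (E : {set V * V}) (x0 y0 x z : V) (i : nat) :
  z \in reach ((x0, y0) |: E) x i ->
  z \in reach E x i \/
  exists j k, [/\ j + k < i, x0 \in reach E x j & z \in reach E y0 k].
Proof.
elim: i z => [|i IHi] z; first by left.
case/reachSP=> w /IHi wx; rewrite in_setU1 => /predU1P[[wE ->]|wz].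
  right; subst w; case: wx => [x0x|[j [k [jk x0x _]]]].
    by exists i, 0; rewrite addn0 ltnSn; split=> //; rewrite inE.
  exists j, 0; split=> //; last by rewrite inE.
  by lia.
case: wx => [wx|[j [k [jk x0x wy]]]].
  by left; apply/reachSP; exists w.
right; exists j, k.+1; split=> //; first by rewrite addnS ltnS.
by apply/reachSP; exists w.
Qed.

(** A closed walk through the new arc leaves, by [reach_add_arc], a shorter walk
from [y0] back to [x0] among the old arcs. *)
Lemma large_girth_add_arc (V : finType) (E : {set V * V}) (x0 y0 : V) (l : nat) :
  large_girth E l -> x0 \notin ball E y0 l ->
  large_girth ((x0, y0) |: E) l.
Proof.
move=> El x0y0 x i /andP[i0 il]; apply/negP => /reach_add_arc[xx|].
  by have := El x i; rewrite i0 il xx => /(_ isT).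
case=> j [k [jk x0x xy0]]; case/negP: x0y0; rewrite inE; apply/existsP.
have kjl : k + j < l by lia.
by exists (Ordinal kjl); apply: reach_trans xy0 x0x.
Qed.

(** * Greedy construction of a joining digraph of large girth *)

(** Averaging: the incidences between [F] and [L] number at least [t * #|F|],
which is at least the fraction [1 / c] of [#|L| * #|F|]. *)
Lemma popular_element (I T : finType) (F : {set I}) (L : {set T})
    (R : I -> {set T}) (c t : nat) :
  0 < t -> F != set0 -> #|L| <= c * t ->
  (forall i, i \in F -> t <= #|R i :&: L|) ->
  exists2 p, p \in L & #|F| <= c * #|[set i in F | p \in R i]|.
Proof.
move=> t0 F0 Lct RL.
have [/exists_inP//|] :=
  boolP [exists p in L, #|F| <= c * #|[set i in F | p \in R i]|].
rewrite negb_exists_in => /forall_inP unpop.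
have F_gt0 : 0 < #|F| by rewrite card_gt0.
have dbl : \sum_(p in L) #|[set i in F | p \in R i]| =
           \sum_(i in F) #|R i :&: L|.
  transitivity (\sum_(p in L) \sum_(i in F | p \in R i) 1).
    by apply: eq_bigr => p _; rewrite -sum1_card; apply: eq_bigl => i; rewrite inE.
  rewrite (exchange_big_dep (mem F)) /=; last by move=> p i _ /andP[].
  apply: eq_bigr => i iF; rewrite -sum1_card; apply: eq_bigl => p.
  by rewrite inE iF /= andbC.
have lo : #|F| * t <= \sum_(p in L) #|[set i in F | p \in R i]|.
  by rewrite dbl -sum_nat_const; apply: leq_sum.
have hi : c * (\sum_(p in L) #|[set i in F | p \in R i]|) <= #|L| * #|F|.-1.
  rewrite big_distrr /= -sum_nat_const; apply: leq_sum => p /unpop.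
  by rewrite -ltnNge => lt; lia.
have c0 : 0 < c.
  case/set0Pn: F0 => i /RL; case: (c) Lct => // L0 tRL.
  have := leq_trans tRL (subset_leq_card (subsetIr _ _)); lia.
have : c * (#|F| * t) <= c * t * #|F|.-1.
  apply: leq_trans (leq_trans (leq_mul (leqnn c) lo) hi) _.
  by rewrite leq_mul2r Lct orbT.
move: (#|F|) F_gt0 => f f0; rewrite -mulnA (mulnC f) !leq_mul2l.
by rewrite (gtn_eqF c0) (gtn_eqF t0) /=; lia.
Qed.

Lemma card_unjoined_add_arc (V : finType) (E : {set V * V}) (a : nat) (p : V * V) :
  #|unjoined (p |: E) a| =
  #|unjoined E a| - #|[set P in unjoined E a | p \in setX P.1 P.2]|.
Proof.
have disjointE (X : {set V * V}) :
    [disjoint X & p |: E] = (p \notin X) && [disjoint X & E].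
  rewrite ![[disjoint X & _]]disjoint_sym -disjointU1.
  by apply: eq_disjoint => z; rewrite !inE.
rewrite -cardsDS; last by apply/subsetP => P; rewrite inE => /andP[].
apply: eq_card => -[A B]; rewrite !inE /= disjointE !inE.
by case: (a <= #|A|); case: (a <= #|B|); case: (p.1 \in A); case: (p.2 \in B);
  case: [disjoint setX A B & E].
Qed.

Lemma card_full_outdeg (V : finType) (E : {set V * V}) (d : nat) :
  d * #|[set x | d <= outdeg E x]| <= #|E|.
Proof.
have -> : #|E| = \sum_x outdeg E x.
  rewrite -sum1_card (eq_bigl (fun p : V * V => (p.1, p.2) \in E)); last by case.
  rewrite -(pair_big_dep xpredT (fun x z => (x, z) \in E) (fun _ _ => 1)) /=.
  by apply: eq_bigr => x _; rewrite /outdeg -sum1_card;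
    apply: eq_bigl => z; rewrite inE.
rewrite mulnC -sum_nat_const [leqRHS](bigID (mem [set x | d <= outdeg E x])) /=.
by apply: leq_trans (leq_addr _ _); apply: leq_sum => x; rewrite inE.
Qed.

Lemma outdeg_add_arc (V : finType) (E : {set V * V}) (x0 y0 : V) (d : nat) :
  (forall x, outdeg E x <= d) -> outdeg E x0 < d ->
  forall x, outdeg ((x0, y0) |: E) x <= d.
Proof.
move=> Ed x0d x; have [->|xx0] := eqVneq x x0; last first.
  apply: leq_trans (Ed x); apply/subset_leq_card/subsetP => z.
  by rewrite !inE xpair_eqE (negbTE xx0).
have sub : [set z | (x0, z) \in (x0, y0) |: E] \subset
           y0 |: [set z | (x0, z) \in E].
  by apply/subsetP => z; rewrite !inE xpair_eqE eqxx.
apply: leq_trans (subset_leq_card sub) _; rewrite cardsU1.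
by move: x0d; rewrite /outdeg; case: (_ \notin _) => /=; lia.
Qed.

(** At most [b] vertices have full outdegree, and at most [b ^ 2] pairs of
vertices would close a short walk, so an unjoined pair of sets of size [2 * b]
still offers [b * (2 * b) - b ^ 2] admissible arcs out of [(2 * q * b) ^ 2].
This is the fraction [1 / (4 * q ^ 2)] gained by the best arc. *)
Lemma greedy_step (V : finType) (E : {set V * V}) (l q b d : nat) :
  0 < b -> 0 < d ->
  #|V| = q * b.*2 -> 2 * q * (l * d ^ l) <= b -> #|E| <= b * d ->
  large_girth E l -> (forall x, outdeg E x <= d) ->
  unjoined E b.*2 != set0 ->
  exists p, [/\ large_girth (p |: E) l, forall x, outdeg (p |: E) x <= d &
    #|unjoined (p |: E) b.*2| * (4 * q ^ 2) <=
    #|unjoined E b.*2| * (4 * q ^ 2).-1].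
Proof.
move=> b0 d0 Vn bl Ebd El Ed F0.
(* The arcs that may be added: room at the tail, no short walk from head to tail. *)
pose L := [set p : V * V | (outdeg E p.1 < d) && (p.1 \notin ball E p.2 l)].
have Lle : #|L| <= 4 * q ^ 2 * b ^ 2.
  by apply: leq_trans (max_card _) _; rewrite card_prod Vn; lia.
have RL (P : {set V} * {set V}) : P \in unjoined E b.*2 ->
    b ^ 2 <= #|setX P.1 P.2 :&: L|.
  case: P => A B; rewrite inE /= => /and3P[Aa Ba _].
  pose full := [set x | d <= outdeg E x].
  have fullb : #|full| <= b.
    have := leq_trans (card_full_outdeg E d) Ebd.
    by rewrite mulnC leq_mul2r (gtn_eqF d0).
  pose near := [set p : V * V | p.1 \in ball E p.2 l].
  have nearb : #|near| <= b ^ 2.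
    have -> : #|near| = \sum_y #|ball E y l|.
      rewrite -sum1_card (eq_bigl (fun p : V * V => p.1 \in ball E p.2 l)); last first.
        by move=> p; rewrite inE.
      rewrite -(pair_big_dep xpredT (fun x y => x \in ball E y l) (fun _ _ => 1)) /=.
      rewrite (exchange_big_dep xpredT) //=; apply: eq_bigr => y _.
      by rewrite sum1_card.
    apply: leq_trans (_ : \sum_(y : V) l * d ^ l <= _).
      by apply: leq_sum => y _; apply: card_ball.
    rewrite sum_nat_const cardT -cardE Vn.
    have := leq_mul bl (leqnn b); lia.
  have sub : setX (A :\: full) B :\: near \subset setX A B :&: L.
    apply/subsetP => -[x y]; rewrite !inE /= -ltnNge.
    by case/and3P=> xy /andP[-> ->] ->; rewrite xy.
  apply: leq_trans (subset_leq_card sub).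
  have Af : b <= #|A :\: full|.
    have := cardsID full A; have := subset_leq_card (subsetIr A full); lia.
  have := cardsID near (setX (A :\: full) B).
  have := subset_leq_card (subsetIr (setX (A :\: full) B) near).
  rewrite cardsX; have := leq_mul Af Ba; lia.
have [] := popular_element _ F0 Lle RL; first by lia.
move=> [x0 y0] x0y0L pop; exists (x0, y0).
move: x0y0L; rewrite inE /= => /andP[x0d x0y0]; split.
- exact: large_girth_add_arc.
- exact: outdeg_add_arc.
have h : forall u v c, u <= c * v -> (u - v) * c <= u * c.-1.
  by move=> u v [|c] uv; rewrite ?muln0 //= mulnBl; lia.
by rewrite card_unjoined_add_arc; apply: h.
Qed.

Lemma greedy_arcs (V : finType) (l q b d m : nat) :
  0 < b -> 0 < d ->
  #|V| = q * b.*2 -> 2 * q * (l * d ^ l) <= b -> m <= b * d ->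
  exists E : {set V * V}, [/\ #|E| <= m, large_girth E l,
    forall x, outdeg E x <= d &
    #|unjoined E b.*2| * (4 * q ^ 2) ^ m <= 4 ^ #|V| * (4 * q ^ 2).-1 ^ m].
Proof.
move=> b0 d0 Vn bl; elim: m => [|m IHm] md.
  exists set0; split; rewrite ?cards0 //.
  - by move=> x [//|i] _; apply/negP => /reachSP[w _]; rewrite inE.
  - by move=> x; rewrite /outdeg eq_card0 // => z; rewrite !inE.
  rewrite !expn0 !muln1; apply: leq_trans (max_card _) _.
  by rewrite card_prod -cardsT -powersetT card_powerset cardsT -expnMn.
have [E [Em El Ed Ec]] := IHm (ltnW md).
have [E0|F0] := eqVneq (unjoined E b.*2) set0.
  by exists E; rewrite E0 cards0 mul0n; split=> //; apply: leqW.
have [p [pl pd pc]] := greedy_step b0 d0 Vn bl (leq_trans Em (ltnW md)) El Ed F0.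
exists (p |: E); split=> //.
  by rewrite cardsU1; case: (_ \notin _); rewrite ?add0n ?add1n ?ltnS // leqW.
rewrite (expnS (4 * q ^ 2)) (expnS (4 * q ^ 2).-1) mulnA.
apply: leq_trans (leq_mul pc (leqnn _)) _.
by rewrite mulnAC [leqRHS]mulnCA mulnC leq_mul2l Ec orbT.
Qed.

(** Bernoulli's inequality for [(1 + 1 / c.-1) ^ c], in natural numbers: [c]
greedy steps halve the number of unjoined pairs. *)
Lemma bernoulli_half (c : nat) : 1 < c -> 2 * c.-1 ^ c <= c ^ c.
Proof.
case: c => // c c0 /=.
rewrite [leqRHS](_ : _ = (c + 1) ^ c.+1); last by rewrite addn1.
rewrite expnDn big_ord_recl big_ord_recl /= /bump /= !exp1n !muln1 subn0 bin0 bin1.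
rewrite mul1n mul2n -addnn; apply: leq_add => //.
apply: leq_trans (leq_addr _ _); rewrite subSS subn0 expnS leq_mul2r leqnSn.
by rewrite orbT.
Qed.

(** The constants are chosen in the order forced by [greedy_step]: [m] steps
suffice to bring [4 ^ n] below [1]; [d] makes [b * d] at least [m], using
[m <= 4 * q ^ 2 * (5 * q * b)]; and [b] dominates the size of the balls, a
bound that depends on [d] and [l] only. *)
Lemma exists_joining (l q : nat) : 0 < l -> 0 < q ->
  exists (a n : nat) (E : {set 'I_n * 'I_n}),
    [/\ 0 < a, n = q * a, large_girth E l & joining E a].
Proof.
move=> l0 q0.
pose d := 20 * q ^ 3; pose b := 2 * q * (l * d ^ l).
have d0 : 0 < d by rewrite muln_gt0 expn_gt0 q0.
have b0 : 0 < b by rewrite !muln_gt0 q0 l0 expn_gt0 d0.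
pose n := q * b.*2; pose c := 4 * q ^ 2; pose m := c * (2 * n).+1.
have n0 : 0 < n by rewrite muln_gt0 q0 double_gt0.
have q20 : 0 < q ^ 2 by rewrite expn_gt0 q0.
have c1 : 1 < c by rewrite /c; lia.
have mbd : m <= b * d.
  rewrite /m /d /c /n.
  have : 4 * q ^ 2 <= 4 * q ^ 3 * b.
    rewrite (expnSr q 2) -(mulnA 4) leq_mul2l -mulnA leq_pmulr //.
    by rewrite muln_gt0 q0.
  move: (b) => B. lia.
have [|E [_ El _ Ec]] := @greedy_arcs 'I_n l q b d m b0 d0 _ (leqnn _) mbd.
  by rewrite card_ord.
exists b.*2, n, E; split; rewrite ?double_gt0 // => A B Aa Ba.
have : unjoined E b.*2 = set0.
  apply/eqP; rewrite -cards_eq0 -leqn0 leqNgt; apply/negP => F0.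
  have : c ^ m <= 4 ^ n * c.-1 ^ m.
    by move: Ec; rewrite card_ord; apply: leq_trans; rewrite leq_pmull.
  have : 4 ^ n * c.-1 ^ m < c ^ m.
    apply: leq_trans (_ : 2 ^ (2 * n).+1 * c.-1 ^ m <= _).
      rewrite ltn_pmul2r ?expn_gt0; last by apply/orP; left; lia.
      by rewrite expnS expnM; apply: ltn_Pmull; rewrite // expn_gt0.
    rewrite /m (expnM c.-1) (expnM c) -expnMn leq_exp2r //; exact: bernoulli_half.
  by rewrite ltnNge => /negP.
move/setP/(_ (A, B)); rewrite !inE /= Aa Ba /= => /pred0Pn[[x y]] /=.
by rewrite in_setX => /andP[/andP[xA yB] xyE]; exists x, y.
Qed.

(** * Passing to a rigid core *)

(** A vertex is forced once one in-neighbour and one out-neighbour are; a set is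
trapped when forcing everything outside it forces none of its vertices. *)
Definition trapped (V : finType) (E : {set V * V}) (S : {set V}) : bool :=
  [forall x in S, [forall y, ((x, y) \in E) ==> (y \in S)] ||
                  [forall y, ((y, x) \in E) ==> (y \in S)]].

(** Half of the vertices of [S] are of the same kind, say with all their
out-neighbours in [S].  As these are [a] vertices, they would be joined to the
complement of [S] if it had size [a]. *)
Lemma trapped_large (V : finType) (E : {set V * V}) (a : nat) (S : {set V}) :
  joining E a -> trapped E S -> a.*2 <= #|S| -> #|~: S| < a.
Proof.
move=> Ea /forall_inP trS Sa; rewrite ltnNge; apply/negP => CSa.
pose So := [set x in S | [forall y, ((x, y) \in E) ==> (y \in S)]].
pose Si := [set x in S | [forall y, ((y, x) \in E) ==> (y \in S)]].
have Soi : #|S| <= #|So| + #|Si|.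
  apply: leq_trans (leq_card_setU So Si).1; apply/subset_leq_card/subsetP => x xS.
  by rewrite !inE xS trS.
have [aSo|Soa] := leqP a #|So|.
  have [x [y [xSo + xy]]] := Ea _ _ aSo CSa; rewrite inE.
  by move: xSo; rewrite inE => /andP[_ /forallP/(_ y)/implyP/(_ xy)] ->.
have aSi : a <= #|Si| by lia.
have [x [y [+ ySi xy]]] := Ea _ _ CSa aSi; rewrite inE.
by move: ySi; rewrite inE => /andP[_ /forallP/(_ x)/implyP/(_ xy)] ->.
Qed.

(** The trace that pointedness leaves on the exponential digraph. *)
Definition loops_isolated (T : Type) (R : rel T) : Prop :=
  forall f g, R f f -> R f g -> R g f -> g = f.

(** The core [U] is the complement of a largest trapped set [B] of size below
[2 * a].  The vertices of [U] outside the unique large colour form, with [B], a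
trapped set of size below [(K + 2) * a], too small to be of the
large kind of [trapped_large]; so by maximality there are none. *)
Lemma constant_core (V : finType) (E : {set V * V}) (a K : nat) :
  0 < a -> #|V| = (K + 3) * a -> joining E a ->
  exists U : {set V}, U != set0 /\
    forall (Col : finType) (R : rel Col) (c : V -> Col),
      #|Col| <= K -> loops_isolated R ->
      (forall x y, x \in U -> y \in U -> (x, y) \in E -> R (c x) (c y)) ->
      exists f, R f f /\ forall x, x \in U -> c x = f.
Proof.
move=> a0 Vn Ea.
pose small S := trapped E S && (#|S| < a.*2).
have small0 : small set0.
  rewrite /small cards0 double_gt0 a0 andbT.
  by apply/forall_inP => x; rewrite inE.
have [B /andP[trB Ba] maxB] := arg_maxnP (fun S : {set V} => #|S|) small0.
pose U := ~: B.
have Un : #|V| = #|B| + #|U| by rewrite cardsC.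
exists U; split; first by rewrite -card_gt0; lia.
move=> Col R c ColK isoR homc.
pose cls f := [set x in U | c x == f].
have cls_sum (P : pred Col) : #|[set x in U | P (c x)]| = \sum_(f | P f) #|cls f|.
  rewrite -sum1_card (partition_big c P) /=; last first.
    by move=> x; rewrite inE => /andP[].
  apply: eq_bigr => f Pf; rewrite -sum1_card; apply: eq_bigl => x.
  by rewrite !inE; case: eqP => [->|]; rewrite ?Pf ?andbT ?andbF.
have clsR f g : a <= #|cls f| -> a <= #|cls g| -> R f g.
  move=> fa ga; have [x [y [+ + xy]]] := Ea _ _ fa ga; rewrite !inE.
  by move=> /andP[xU /eqP <-] /andP[yU /eqP <-]; apply: homc; rewrite ?inE.
have small_sum (P : pred Col) : (forall f, P f -> #|cls f| < a) ->
    #|[set x in U | P (c x)]| <= K * a.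
  move=> Psmall; rewrite cls_sum; apply: leq_trans (_ : \sum_(f | P f) a <= _).
    by apply: leq_sum => f /Psmall/ltnW.
  rewrite sum_nat_const leq_mul2r; apply/orP; right.
  exact: leq_trans (max_card _) ColK.
(* Otherwise U would have at most K * a elements, but it has more. *)
have [f fa] : exists f, a <= #|cls f|.
  have [/existsP//|] := boolP [exists f, a <= #|cls f|].
  rewrite negb_exists => /forallP none.
  have := small_sum xpredT (fun f _ => ltac:(by rewrite ltnNge)).
  have -> : [set x in U | xpredT (c x)] = U by apply/setP => x; rewrite inE andbT.
  by lia.
have fR : R f f by apply: clsR.
exists f; split=> //.
pose bad := [set x in U | c x != f].
have badK : #|bad| <= K * a.
  apply: (small_sum (predC1 f)) => g /= gf; rewrite ltnNge; apply/negP => ga.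
  by case/eqP: gf; apply: isoR => //; apply: clsR.
have tr : trapped E (bad :|: B).
  apply/forall_inP => x; rewrite inE; case/orP=> [xbad|xB]; last first.
    have /orP[] := forall_inP trB _ xB => /forallP h; apply/orP; [left|right];
      by apply/forallP => y; apply/implyP => /(implyP (h y)); rewrite inE => ->;
         rewrite orbT.
  apply/negPn/negP; rewrite negb_or !negb_forall.
  case/andP=> /existsP[y +] /existsP[z]; rewrite !negb_imply !in_setU !negb_or.
  case/andP=> xy /andP[ybad yB] /andP[zx /andP[zbad zB]].
  have good w : w \notin bad -> w \notin B -> w \in U /\ c w = f.
    move=> + wB; have wU : w \in U by rewrite inE.
    by rewrite inE wU /= negbK => /eqP.
  move: xbad; rewrite inE => /andP[xU /eqP]; apply.
  have [[yU cy] [zU cz]] := (good y ybad yB, good z zbad zB).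
  by apply: isoR => //; [rewrite -cz | rewrite -cy]; apply: homc.
have dis : #|bad :|: B| = #|bad| + #|B|.
  apply/eqP; rewrite (leq_card_setU bad B).2 disjoint_subset.
  by apply/subsetP => x; rewrite !inE => /andP[].
have badB : #|bad :|: B| < a.*2.
  rewrite ltnNge; apply/negP => /(trapped_large Ea tr).
  have := cardsC (bad :|: B); rewrite dis; lia.
have := maxB (bad :|: B); rewrite /small tr badB dis => /(_ isT) bad0.
move=> x xU; apply/eqP; apply/negPn/negP => cxf.
have : 0 < #|bad| by apply/card_gt0P; exists x; rewrite inE xU.
by move: bad0; clear; lia.
Qed.

Lemma path_reach (V : finType) (E : {set V * V}) (x : V) (p : seq V) :
  path (fun y z => (y, z) \in E) x p -> last x p \in reach E x (size p).
Proof.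
elim/last_ind: p => [|p y IHp]; first by rewrite inE.
rewrite rcons_path last_rcons size_rcons => /andP[/IHp px pxy].
by apply/reachSP; exists (last x p).
Qed.

(** The digraph induced on the core.  A colouring of it extends to all vertices
with the colour of the base point [w0], which the arcs inside the core do not
see. *)
Lemma exists_rigid_digraph (l K : nat) : 0 < l ->
  exists (W : finType) (r : rel W),
    [/\ forall x p, path r x p -> last x p = x -> 0 < size p -> l <= size p,
        0 < #|W| &
        forall (Col : finType) (R : rel Col) (c : W -> Col),
          #|Col| <= K -> loops_isolated R ->
          (forall x y, r x y -> R (c x) (c y)) ->
          exists f, R f f /\ forall x, c x = f].
Proof.
move=> l0.
have [|a [n [E [a0 nE El Ea]]]] := @exists_joining l (K + 3) l0.
  by rewrite addn3.
have [|U [U0 UP]] := @constant_core _ E a K a0 _ Ea; first by rewrite card_ord.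
exists {x : 'I_n | x \in U}, (fun x y => (val x, val y) \in E).
case/set0Pn: U0 => u0 Uu0; pose w0 : {x | x \in U} := exist _ u0 Uu0.
split.
- move=> x p xp px p0; rewrite leqNgt; apply/negP => pl.
  have := El (val x) (size p); rewrite p0 pl => /(_ isT) /negP; apply.
  rewrite -{1}px -last_map -(size_map val); apply: path_reach.
  by rewrite path_map.
- by apply/card_gt0P; exists w0.
move=> Col R c ColK isoR homc.
have [x y xU yU xy|f [fR cf]] := UP Col R (fun v => c (insubd w0 v)) ColK isoR.
  by apply: homc; rewrite !insubdK.
exists f; split=> // x; by rewrite -(cf _ (valP x)) valKd.
Qed.

(** * Products and exponentials *)

Definition product_arc (D : oriented_graph) (W : finType) (r : rel W) :
    rel (D * W) :=
  fun u v => arc u.1 v.1 && r u.2 v.2.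

Lemma product_arc_irrefl (D : oriented_graph) (W : finType) (r : rel W) :
  irreflexive (@product_arc D W r).
Proof. by move=> u; rewrite /product_arc arc_irrefl. Qed.

Lemma product_arc_antisym (D : oriented_graph) (W : finType) (r : rel W)
    (u v : D * W) :
  ~~ (product_arc r u v && product_arc r v u).
Proof.
apply: contra (arc_antisym u.1 v.1).
by case/andP=> /andP[-> _] /andP[-> _].
Qed.

Definition product_graph (D : oriented_graph) (W : finType) (r : rel W) :
    oriented_graph :=
  OrientedGraph (@product_arc_irrefl D W r) (@product_arc_antisym D W r).

(** A directed cycle projects to a closed walk of the same length. *)
Lemma girth_product (D : oriented_graph) (W : finType) (r : rel W) (l : nat) :
  (forall x p, path r x p -> last x p = x -> 0 < size p -> l <= size p) ->
  girth_geq (product_graph D r) l.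
Proof.
move=> rl; rewrite /girth_geq; case g_eq: (girth _) => [g|] //.
have [/has_dicycleP[c [g_gt0 g_def /andP[cyc _]]] _] := (girth_SomeP _ _).1 g_eq.
move: g_gt0 cyc; rewrite -{}g_def; case: c => [//|x p] /= _ xp.
have := rl x.2 (map snd (rcons p x)).
rewrite path_map last_map last_rcons size_map size_rcons; apply=> //.
by apply: sub_path xp => u v /andP[].
Qed.

(** The arcs of the exponential digraph; its loops are the homomorphisms. *)
Definition expo_arc (D C : oriented_graph) : rel {ffun D -> C} :=
  fun f g => [forall u : D, forall v : D, arc u v ==> arc (f u) (g v)].

Lemma expo_arcP (D C : oriented_graph) (f g : {ffun D -> C}) :
  reflect (forall u v : D, arc u v -> arc (f u) (g v)) (expo_arc f g).
Proof.
apply: (iffP forallP) => [fg u v uv|fg u]; last first.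
  by apply/forallP => v; apply/implyP; apply: fg.
by move/forallP/(_ v)/implyP: (fg u); apply.
Qed.

(** The vertex [v] carries no loop, so an arc of [D] has at most one end at [v].
Hence changing [f] at [v] alone into [g] uses only arcs between [f] and [g],
in either direction, and arcs from [f] to itself. *)
Lemma pointed_loops_isolated (D C : oriented_graph) :
  pointed D C -> loops_isolated (@expo_arc D C).
Proof.
move=> ptC f g /expo_arcP ff /expo_arcP fg /expo_arcP gf; apply/ffunP => v.
pose h := [ffun u => if u == v then g u else f u].
have homh : is_hom h.
  move=> x y xy; rewrite !ffunE.
  have [xv|_] := eqVneq x v; have [yv|_] := eqVneq y v.
  - by move: xy; rewrite xv yv arc_irrefl.
  - exact: gf.
  - exact: fg.
  - exact: ff.
have [/ffunP/(_ v)|/eqP hf] := eqVneq h f; first by rewrite ffunE eqxx.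
case: ptC; exists h, f; split=> //; exists v => u /eqP uv.
by rewrite ffunE (negbTE uv).
Qed.

Definition curried (D C : oriented_graph) (W : finType) (r : rel W)
    (phi : {ffun product_graph D r -> C}) (w : W) : {ffun D -> C} :=
  [ffun v => phi (v, w)].

Lemma curried_hom (D C : oriented_graph) (W : finType) (r : rel W)
    (phi : {ffun product_graph D r -> C}) :
  is_hom phi -> forall x y, r x y -> expo_arc (curried phi x) (curried phi y).
Proof.
move=> homphi x y xy; apply/expo_arcP => u v uv; rewrite !ffunE.
by apply: homphi; apply/andP.
Qed.

Theorem theorem1p1 (D : oriented_graph) (k l : nat) (k_gt0 : 0 < k)
    (l_gt0 : 0 < l) :
  exists (Dstar : oriented_graph) (psi : {ffun Dstar -> D}),
    is_hom psi /\ surjective psi /\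
    girth_geq Dstar l /\
    (forall C : oriented_graph, #|vertex C| <= k ->
       (hom_exists Dstar C <-> hom_exists D C)) /\
    (forall C : oriented_graph, #|vertex C| <= k -> pointed D C ->
       forall phi : {ffun Dstar -> C}, is_hom phi ->
       exists! f : {ffun D -> C},
         is_hom f /\ forall x : Dstar, phi x = f (psi x)).
Proof.
have [W [r [rl /card_gt0P[w0 _] rigid]]] := exists_rigid_digraph (k ^ #|D|) l_gt0.
have colK (C : oriented_graph) : #|C| <= k -> #|{ffun D -> C}| <= k ^ #|D|.
  by move=> Ck; rewrite card_ffun; case: (#|D|) => [|n] //; rewrite leq_exp2r.
pose psi : {ffun product_graph D r -> D} := [ffun u => u.1].
have hom_psi : is_hom psi by move=> u v /andP[uv _]; rewrite !ffunE.
exists (product_graph D r), psi; split=> //; split.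
  by move=> v; exists (v, w0); rewrite ffunE.
split; first exact: girth_product.
split=> [C Ck|C Ck ptC phi homphi].
  split=> [[phi homphi]|[f homf]]; last first.
    exists [ffun x => f (psi x)] => x y xy; rewrite !ffunE.
    by apply: homf; case/andP: xy.
  (* Without a loop, all loops are isolated, and rigidity would yield a loop. *)
  have [/existsP[f /expo_arcP homf]|no_loop] :=
    boolP [exists f : {ffun D -> C}, expo_arc f f]; first by exists f.
  have isolated : loops_isolated (@expo_arc D C).
    by move=> f g ff; case/existsP: no_loop; exists f.
  have [f [/expo_arcP homf _]] :=
    rigid _ _ _ (colK C Ck) isolated (curried_hom homphi).
  by exists f.
have [f [/expo_arcP homf phif]] :=
  rigid _ _ _ (colK C Ck) (pointed_loops_isolated ptC) (curried_hom homphi).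
exists f; split; first split=> // -[v w].
  by rewrite -(phif w) !ffunE.
move=> g [_ phig]; apply/ffunP => v.
by rewrite -(phif w0) ffunE phig ffunE.
Qed.
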